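(* Let $a_c>b_c>0$, $k_e>0$, $a_e^2=a_c^2+k_e$, $b_e^2=b_c^2+k_e$, let $c$ be the ellipse $x^2/a_c^2+y^2/b_c^2=1$ and $e$ the ellipse $x^2/a_e^2+y^2/b_e^2=1$. Let $P_1P_2\dots P_N$ be an $N$-sided periodic billiard in $e$ with caustic $c$, let $Q_i$ be the contact point of $[P_i,P_{i+1}]$ with $c$, and put $l_i=\overline{P_iQ_i}$, $r_i=\overline{P_iQ_{i-1}}$ (indices modulo $N$). If $N=2n$, then $r_{i+n}=r_i$ and $l_{i+n}=l_i$ for all $i$. If $N=2n+1$, then $r_{i+n}=l_{i-1}$ and $l_{i+n}=r_i$ for all $i$; consequently, for odd $N$, $$\sum_{i=1}^N l_i=\sum_{i=1}^N r_i=\frac{L_e}{2},$$ where $L_e=\sum_{i=1}^N\overline{P_iP_{i+1}}$ is the perimeter of the billiard.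
   Context: A billiard in $e$ with caustic $c$ is a sequence $(P_i)_{i\in\mathbb Z}$ of points of $e$ with $P_{i+1}\neq P_i$ such that every line $[P_i,P_{i+1}]$ is tangent to $c$ and $[P_{i-1},P_i]\neq[P_i,P_{i+1}]$; it is $N$-sided periodic if $P_{i+N}=P_i$ for all $i$, $N$ being the least such positive integer. $\overline{XY}$ denotes Euclidean distance. *)

(* Defs.v *)
From mathcomp Require Import all_boot all_order all_algebra.
From mathcomp Require Export reals.
Set Implicit Arguments. Unset Strict Implicit. Unset Printing Implicit Defensive.
Import Order.TTheory GRing.Theory Num.Theory.
Local Open Scope ring_scope.

Section Defs.
Variable R : realType.
Definition point := (R * R)%type.

Definition on_ellipse (a b : R) (X : point) : Prop :=
  X.1 ^+ 2 / a ^+ 2 + X.2 ^+ 2 / b ^+ 2 = 1.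

Definition on_line (A B X : point) : Prop :=
  exists t : R, X = (A.1 + t * (B.1 - A.1), A.2 + t * (B.2 - A.2)).

Definition same_line (A B C D : point) : Prop :=
  forall X, on_line A B X <-> on_line C D X.

Definition contact_point (a b : R) (A B T : point) : Prop :=
  on_ellipse a b T /\ on_line A B T /\
  forall X, on_ellipse a b X -> on_line A B X -> X = T.

Definition tangent_line (a b : R) (A B : point) : Prop :=
  exists T, contact_point a b A B T.

Definition billiard (ae be ac bc : R) (P : int -> point) : Prop :=
  forall i : int,
    [/\ on_ellipse ae be (P i),
        P (i + 1) <> P i,
        tangent_line ac bc (P i) (P (i + 1))
      & ~ same_line (P (i - 1)) (P i) (P i) (P (i + 1))].

Definition periodic_billiard (ae be ac bc : R) (N : nat) (P : int -> point) :=
  [/\ billiard ae be ac bc P,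
      (0 < N)%N,
      forall i : int, P (i + N%:Z) = P i
    & forall m : nat, (0 < m < N)%N -> exists i : int, P (i + m%:Z) <> P i].

Definition dist (X Y : point) : R :=
  Num.sqrt ((X.1 - Y.1) ^+ 2 + (X.2 - Y.2) ^+ 2).

End Defs.

(* Main.v *)
Require Import Defs.
From mathcomp Require Import all_boot all_order all_algebra reals.
From mathcomp Require Import zify ring lra.
Set Implicit Arguments. Unset Strict Implicit. Unset Printing Implicit Defensive.
Import Order.TTheory GRing.Theory Num.Theory.
Local Open Scope ring_scope.

(* In the coordinates [(x / a, y / b)] of either ellipse, vertices and contact
   points are unit vectors, and incidence of a vertex [u] with the tangent at
   [v] reads [K u_1 v_1 + L u_2 v_2 = 1] with [K = a_e / a_c], [L = b_e / b_c].
   As this is symmetric in [u] and [v], the interleaved sequence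
   [P_0, Q_0, P_1, Q_1, ...] is the orbit [x] of one map of the circle: each term
   is followed by the solution other than its predecessor.  That map preserves
   the sign of [det (x, y)], so [x_{j + 2 N} = x_j] forces
   [det (x_j, x_{j + N}) = 0], i.e. [x_{j + N} = e x_j] with [e = 1] or [-1].
   Ivory's theorem (swapping the normalized coordinates of a point of [e] and a
   point of [c] preserves their distance) turns this into the equalities. *)

(** * Conjugate unit vectors: signs of turns and determinants *)

Section Circle.
Variables (R : realFieldType) (K L : R).
Implicit Types u v y z : R * R.

Definition scale (e : R) u : R * R := (e * u.1, e * u.2).
Definition det2 u v : R := u.1 * v.2 - u.2 * v.1.
Definition unit2 u : Prop := u.1 ^+ 2 + u.2 ^+ 2 = 1.
Definition conjugate u v : Prop := K * u.1 * v.1 + L * u.2 * v.2 = 1.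
(* The sign of [turn u v] tells apart the two unit vectors [v] conjugate to [u]. *)
Definition turn u v : R := K * u.1 * v.2 - L * u.2 * v.1.
(** Squared length of [(K u_1, L u_2)], a normal of the line of vectors conjugate to [u]. *)
Definition pole2 u : R := K ^+ 2 * u.1 ^+ 2 + L ^+ 2 * u.2 ^+ 2.

Lemma conjugateC u v : conjugate u v -> conjugate v u.
Proof. by rewrite /conjugate => <-; ring. Qed.

Lemma det2C u v : det2 v u = - det2 u v.
Proof. by rewrite /det2; ring. Qed.

(** The scalar is the dot product; by Lagrange's identity its square is 1 once the determinant
    vanishes. *)
Lemma det2_eq0 u v : unit2 u -> unit2 v -> det2 u v = 0 ->
  exists2 e : R, e ^+ 2 = 1 & v = scale e u.
Proof.
case: u v => [a b] [c d]; rewrite /unit2 /det2 /= => hu hv hd.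
exists (a * c + b * d).
  have -> : (a * c + b * d) ^+ 2
     = (a ^+ 2 + b ^+ 2) * (c ^+ 2 + d ^+ 2) - (a * d - b * c) ^+ 2 by ring.
  by rewrite hu hv hd; ring.
congr pair.
- have -> : (a * c + b * d) * a = (a ^+ 2 + b ^+ 2) * c + b * (a * d - b * c) by ring.
  by rewrite hu hd; ring.
- have -> : (a * c + b * d) * b = (a ^+ 2 + b ^+ 2) * d - a * (a * d - b * c) by ring.
  by rewrite hu hd; ring.
Qed.

Lemma unit2_dot u v : unit2 u -> unit2 v ->
  [/\ u.1 * v.1 <= 1, u.2 * v.2 <= 1 & `|u.1 * v.1 + u.2 * v.2| <= 1].
Proof.
rewrite /unit2 => hu hv.
have le2 (x y : R) : 1 + 1 - (x + x) = y -> 0 <= y -> x <= 1.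
  by move=> e y0; move: e; lra.
rewrite ler_norml lerNl; split; last apply/andP; last split.
- apply: (@le2 _ ((u.1 - v.1) ^+ 2 + (u.2 ^+ 2 + v.2 ^+ 2))).
    by rewrite -{1}hu -hv; ring.
  by rewrite !addr_ge0 ?sqr_ge0.
- apply: (@le2 _ ((u.2 - v.2) ^+ 2 + (u.1 ^+ 2 + v.1 ^+ 2))).
    by rewrite -{1}hu -hv; ring.
  by rewrite !addr_ge0 ?sqr_ge0.
- apply: (@le2 _ ((u.1 + v.1) ^+ 2 + (u.2 + v.2) ^+ 2)).
    by rewrite -{1}hu -hv; ring.
  by rewrite addr_ge0 ?sqr_ge0.
- apply: (@le2 _ ((u.1 - v.1) ^+ 2 + (u.2 - v.2) ^+ 2)).
    by rewrite -{1}hu -hv; ring.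
  by rewrite addr_ge0 ?sqr_ge0.
Qed.

Lemma pole2_sub1 u : unit2 u ->
  pole2 u - 1 = (K ^+ 2 - 1) * u.1 ^+ 2 + (L ^+ 2 - 1) * u.2 ^+ 2.
Proof. by move=> hu; rewrite /pole2 -{1}hu; ring. Qed.

(** Lagrange's identity for [(K u_1, L u_2)] and [v]: their dot product is 1 and their determinant
    is [turn u v]. *)
Lemma turn_sqr u v : unit2 v -> conjugate u v -> turn u v ^+ 2 = pole2 u - 1.
Proof.
rewrite /unit2 /conjugate /turn /pole2 => hv huv.
have -> : (K * u.1 * v.2 - L * u.2 * v.1) ^+ 2 =
  (K ^+ 2 * u.1 ^+ 2 + L ^+ 2 * u.2 ^+ 2) * (v.1 ^+ 2 + v.2 ^+ 2)
   - (K * u.1 * v.1 + L * u.2 * v.2) ^+ 2 by ring.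
by rewrite hv huv; ring.
Qed.

(** Expansion of [v] in the orthogonal frame of [(K u_1, L u_2)] and its quarter turn, with
    coefficients 1 and [turn u v]. Hence [u] and [turn u v] determine [v] when [pole2 u] is
    nonzero. *)
Lemma conjugateP u v : conjugate u v ->
  pole2 u * v.1 = K * u.1 - turn u v * (L * u.2) /\
  pole2 u * v.2 = L * u.2 + turn u v * (K * u.1).
Proof.
rewrite /conjugate => huv; rewrite -[X in X - _]mul1r -[X in _ /\ _ = X + _]mul1r -huv.
by rewrite /turn /pole2; split; ring.
Qed.

Hypotheses (K1 : 1 < K) (KL : K < L).

Lemma sqr_coefs : 1 < K ^+ 2 /\ K ^+ 2 < L ^+ 2.
Proof.
have [k1 kl] := (K1, KL).
by split; [rewrite exprn_egt1 | rewrite ltrXn2r //; lra].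
Qed.

Lemma pole2_gt1 u : unit2 u -> 1 < pole2 u.
Proof.
have [k1 kl] := (K1, KL); have [k2 l2] := sqr_coefs.
rewrite /unit2 /pole2 => hu.
have -> : K ^+ 2 * u.1 ^+ 2 + L ^+ 2 * u.2 ^+ 2
  = K ^+ 2 * (u.1 ^+ 2 + u.2 ^+ 2) + (L ^+ 2 - K ^+ 2) * u.2 ^+ 2 by ring.
have : 0 <= (L ^+ 2 - K ^+ 2) * u.2 ^+ 2 by rewrite mulr_ge0 ?sqr_ge0 //; lra.
rewrite hu; lra.
Qed.

(** The turns from [v] to [z] and to [u] agree up to sign. Equality would give [z = u], so they are
    opposite. *)
Lemma turn_other u v z : unit2 u -> unit2 v -> unit2 z ->
  conjugate u v -> conjugate v z -> z <> u -> 0 < turn u v * turn v z.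
Proof.
have [k1 kl] := (K1, KL); have [k2 l2] := sqr_coefs.
move=> hu hv hz huv hvz zNu.
have mv := pole2_gt1 hv.
have /eqP : turn v z ^+ 2 = turn v u ^+ 2.
  by rewrite !turn_sqr //; exact: conjugateC.
rewrite eqf_sqr => /orP[/eqP e|/eqP ->].
  case: zNu; have [z1 z2] := conjugateP hvz; have [u1 u2] := conjugateP (conjugateC huv).
  have m0 : pole2 v != 0 by lra.
  by apply: injective_projections; apply: (mulfI m0);
     rewrite ?z1 ?z2 ?u1 ?u2 e.
(* With [p = u_1 v_1] and [q = u_2 v_2], conjugacy reduces the goal to [L p + K q < K L]. *)
have -> : turn u v * - turn v u
  = K * L * ((u.1 ^+ 2 + u.2 ^+ 2) * (v.1 ^+ 2 + v.2 ^+ 2))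
    - (K * u.1 * v.1 + L * u.2 * v.2) * (L * (u.1 * v.1) + K * (u.2 * v.2)).
  by rewrite /turn; ring.
rewrite hu hv huv !mul1r mulr1.
set p := u.1 * v.1; set q := u.2 * v.2.
have [] : [/\ p <= 1, q <= 1 & `|p + q| <= 1] by exact: unit2_dot.
rewrite ler_norml => hp hq /andP[_ hpq].
have KLK : K < K * L by rewrite ltr_pMr; lra.
have KLL : L < K * L by rewrite ltr_pMl; lra.
clear hu hv hz huv hvz zNu mv.
case: (lerP p 0) => p0; case: (lerP q 0) => q0.
- have : L * p <= 0 by rewrite pmulr_rle0 //; lra.
  have : K * q <= 0 by rewrite pmulr_rle0 //; lra.
  lra.
- have : L * p <= 0 by rewrite pmulr_rle0 //; lra.
  have : K * q <= K by rewrite ger_pMr //; lra.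
  lra.
- have : K * q <= 0 by rewrite pmulr_rle0 //; lra.
  have : L * p <= L by rewrite ger_pMr //; lra.
  lra.
- have : 0 < (K * L - L) * p + (K * L - K) * q + K * L * (1 - p - q).
    apply: ltr_wpDr; first by apply: mulr_ge0; lra.
    by apply: addr_gt0; apply: mulr_gt0; lra.
  lra.
Qed.

(** After squaring, the coefficients of [u_2^2] compare because [L^2 - K^2] is below both [L^2 - 1]
    and [K^2 L^2]; the [u_1^2] term is nonnegative. *)
Lemma turn_bound u v : unit2 u -> unit2 v -> conjugate u v ->
  (L ^+ 2 - K ^+ 2) * `|u.2| < K * L * `|turn u v|.
Proof.
have [k1 kl] := (K1, KL); have [k2 l2] := sqr_coefs.
move=> hu hv huv; have ht := turn_sqr hv huv.
have mu := pole2_gt1 hu.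
rewrite -(@ltr_pXn2r _ 2) ?nnegrE //; last 2 first.
- by rewrite mulr_ge0 //; lra.
- by rewrite !mulr_ge0 //; lra.
rewrite !exprMn !real_normK ?num_real // ht (pole2_sub1 hu).
move: hu; rewrite /unit2.
have := sqr_ge0 u.1; have := sqr_ge0 u.2.
move: (u.1 ^+ 2) (u.2 ^+ 2) (K ^+ 2) (L ^+ 2) k2 l2 => a b k l k2 l2 b0 a0 ab.
clear k1 kl ht mu huv hv; have kl0 : 0 < k * l by apply: mulr_gt0; lra.
have lkl : l < k * l by rewrite ltr_pMl //; lra.
have h3 : (l - k) ^+ 2 < (k * l) * (l - 1).
  apply: le_lt_trans (_ : _ <= (l - k) * (l - 1)) _.
    by rewrite expr2 ler_pM2l; lra.
  by rewrite ltr_pM2r; lra.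
have h4 : 0 <= k * l * ((k - 1) * a) by rewrite !mulr_ge0 //; lra.
(* At [b = 0] both [b] terms vanish, and strictness comes from [a = 1]. *)
rewrite mulrDr; case: (eqVneq b 0) => [b00|bn0].
  rewrite b00 !mulr0 addr0; have -> : a = 1 by lra.
  by rewrite mulr1; apply: mulr_gt0; lra.
have b1 : 0 < b by rewrite lt0r bn0.
by have : (l - k) ^+ 2 * b < k * l * (l - 1) * b; [rewrite ltr_pM2r | lra].
Qed.

(* With [m = pole2], [s = turn] one has
   [m_u m_y det2 v z = K L det2 u y (1 + s_u s_y) - p (s_u - s_y)], where
   [p = K^2 u1 y1 + L^2 u2 y2]; the second term is dominated by the first since
   [|p| <= 1 + s_u s_y] by Cauchy-Schwarz and
   [(s_u - s_y) (s_u + s_y) = m_u - m_y] is a multiple of [det2 u y]. *)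
Lemma det2_conjugate u v y z : unit2 u -> unit2 v -> unit2 y -> unit2 z ->
  conjugate u v -> conjugate y z -> 0 < turn u v * turn y z ->
  0 < det2 u y -> 0 < det2 v z.
Proof.
have [k1 kl] := (K1, KL); have [k2 l2] := sqr_coefs.
move=> hu hv hy hz huv hyz tt D0.
have bu := turn_bound hu hv huv; have by_ := turn_bound hy hz hyz.
have su := turn_sqr hv huv; have sy := turn_sqr hz hyz.
have mu := pole2_gt1 hu; have my := pole2_gt1 hy.
have [v1 v2] := conjugateP huv; have [z1 z2] := conjugateP hyz.
set s := turn u v in tt bu su v1 v2 *; set t := turn y z in tt by_ sy z1 z2 *.
pose p := K ^+ 2 * (u.1 * y.1) + L ^+ 2 * (u.2 * y.2).
have E : pole2 u * pole2 y * det2 v z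
    = K * L * det2 u y * (1 + s * t) - p * (s - t).
  have -> : pole2 u * pole2 y * det2 v z =
    (pole2 u * v.1) * (pole2 y * z.2) - (pole2 u * v.2) * (pole2 y * z.1).
    by rewrite /det2; ring.
  by rewrite v1 v2 z1 z2 /p /det2; ring.
have mm : 0 < pole2 u * pole2 y by apply: mulr_gt0; lra.
rewrite -(pmulr_rgt0 _ mm) E subr_gt0.
have hp : `|p| <= 1 + s * t.
  (* The dot product is at most 1. The rest falls to Cauchy-Schwarz with weights [K^2 - 1] and
     [L^2 - 1], whose quadratic form takes the values [s^2] at [u] and [t^2] at [y]. *)
  have -> : p = (u.1 * y.1 + u.2 * y.2)
     + ((K ^+ 2 - 1) * (u.1 * y.1) + (L ^+ 2 - 1) * (u.2 * y.2)).
    by rewrite /p; ring.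
  apply: le_trans (ler_normD _ _) _; apply: lerD.
    by case: (unit2_dot hu hy).
  rewrite -(@ler_pXn2r _ 2) ?nnegrE ?normr_ge0 ?(ltW tt) //.
  rewrite real_normK ?num_real // exprMn su sy.
  rewrite (pole2_sub1 hu) (pole2_sub1 hy) -subr_ge0.
  have -> : forall k l : R, (k * u.1 ^+ 2 + l * u.2 ^+ 2)
     * (k * y.1 ^+ 2 + l * y.2 ^+ 2) - (k * (u.1 * y.1) + l * (u.2 * y.2)) ^+ 2
     = k * l * det2 u y ^+ 2 by move=> k l; rewrite /det2; ring.
  by rewrite !mulr_ge0 ?sqr_ge0 //; lra.
have hst : (s - t) * (s + t)
    = - ((L ^+ 2 - K ^+ 2) * det2 u y * (u.1 * y.2 + u.2 * y.1)).
  have -> : (s - t) * (s + t) = s ^+ 2 - t ^+ 2 by ring.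
  rewrite su sy.
  have -> : pole2 u - 1 - (pole2 y - 1) =
    pole2 u * (y.1 ^+ 2 + y.2 ^+ 2) - pole2 y * (u.1 ^+ 2 + u.2 ^+ 2).
    by rewrite hu hy; ring.
  by rewrite /pole2 /det2; ring.
have hS : `|u.1 * y.2 + u.2 * y.1| <= `|u.2| + `|y.2|.
  apply: le_trans (ler_normD _ _) _; rewrite !normrM addrC.
  have n1 w : unit2 w -> `|w.1| <= 1.
    rewrite /unit2 => hw; rewrite -(@ler_pXn2r _ 2) ?nnegrE //.
    by rewrite real_normK ?num_real // expr1n; have := sqr_ge0 w.2; lra.
  by apply: lerD; [apply: ler_piMr|apply: ler_piMl]; rewrite ?n1.
(* Since [s] and [t] have the same sign, the two instances of [turn_bound] can be added. *)
have nst : `|s + t| = `|s| + `|t|.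
  have [s0|s0] := ltrP 0 s.
    have t0 : 0 < t by rewrite -(pmulr_rgt0 _ s0).
    by rewrite !gtr0_norm //; lra.
  have s1 : s < 0.
    by rewrite lt_neqAle s0 andbT; apply/eqP => e; move: tt; rewrite e; lra.
  have t0 : t < 0 by rewrite -(nmulr_rgt0 _ s1).
  by rewrite !ltr0_norm //; lra.
have lk : 0 < L ^+ 2 - K ^+ 2 by lra.
have hlt : `|s - t| < K * L * det2 u y.
  have st0 : 0 < `|s + t|.
    rewrite normr_gt0; apply/eqP => st; move: tt.
    have -> : t = - s by lra.
    by rewrite mulrN oppr_gt0 -expr2 ltNge sqr_ge0.
  rewrite -(ltr_pM2r st0) -normrM hst normrN !normrM (gtr0_norm lk) (gtr0_norm D0).
  rewrite mulrAC [ltRHS]mulrAC ltr_pM2r // nst.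
  apply: le_lt_trans (_ : _ <= (L ^+ 2 - K ^+ 2) * (`|u.2| + `|y.2|)) _.
    by rewrite ler_pM2l.
  lra.
apply: le_lt_trans (ler_norm _) _; rewrite normrM mulrC.
have st1 : 0 < 1 + s * t by lra.
apply: le_lt_trans (_ : _ <= `|s - t| * (1 + s * t)) _.
  exact: ler_wpM2l.
by rewrite ltr_pM2r.
Qed.

(** * Orbits on the circle and their half period *)

Variable x : nat -> R * R.
Hypotheses (xU : forall j, unit2 (x j)) (xC : forall j, conjugate (x j) (x j.+1))
  (xN : forall j, x j.+2 <> x j).

(** Consecutive turns agree in sign by [turn_other]; the sign passes on through
    [(a c) b^2 = (a b) (b c)]. *)
Lemma turn_orbit j : 0 < turn (x 0) (x 1) * turn (x j) (x j.+1).
Proof.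
elim: j => [|j IH].
  rewrite -expr2 turn_sqr //; have := pole2_gt1 (xU 0); lra.
have H := turn_other (xU j) (xU j.+1) (xU j.+2) (xC j) (xC j.+1) (@xN j).
move: (turn (x 0) _) (turn (x j) _) (turn (x j.+1) _) IH H => a b c ab bc.
have : 0 < (a * c) * b ^+ 2 by have := mulr_gt0 ab bc; lra.
rewrite pmulr_lgt0 // lt0r sqr_ge0 andbT sqrf_eq0; apply/eqP => b0.
by move: ab; rewrite b0; lra.
Qed.

Lemma turn_orbit2 j k : 0 < turn (x j) (x j.+1) * turn (x k) (x k.+1).
Proof.
have := turn_orbit j; have := turn_orbit k.
move: (turn _ _) (turn (x j) _) (turn (x k) _) => a b c ac ab.
have : 0 < (b * c) * a ^+ 2 by have := mulr_gt0 ab ac; lra.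
rewrite pmulr_lgt0 // lt0r sqr_ge0 andbT sqrf_eq0; apply/eqP => a0.
by move: ab; rewrite a0; lra.
Qed.

Lemma det2_orbit j k m : 0 < det2 (x j) (x k) -> 0 < det2 (x (m + j)) (x (m + k)).
Proof.
move=> h; elim: m => // m IH; rewrite !addSn.
by apply: det2_conjugate IH => //; exact: turn_orbit2.
Qed.

(* If [x 0] and [x N] were independent, their orientation would be preserved by
   [N] steps, whereas these exchange both points. *)
Lemma half_period N : x (N + N) = x 0 ->
  exists2 e : R, e ^+ 2 = 1 & x N = scale e (x 0).
Proof.
move=> xNN; apply: det2_eq0 => //.
case: (ltrgtP 0 (det2 (x 0) (x N))) => // d.
  by have := det2_orbit N d; rewrite addn0 xNN det2C; lra.
have d' : 0 < det2 (x N) (x 0) by rewrite det2C; lra.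
by have := det2_orbit N d'; rewrite addn0 xNN det2C; lra.
Qed.

End Circle.

Lemma half_period_pair (R : realFieldType) (K L : R) (x : nat -> R * R) N :
  1 < K -> K < L -> (forall j, unit2 (x j)) ->
  (forall j, conjugate K L (x j) (x j.+1)) -> (forall j, x j.+2 <> x j) ->
  (forall j, x (j + (N + N))%N = x j) ->
  forall j, exists2 e : R, e ^+ 2 = 1 &
    x (j + N)%N = scale e (x j) /\ x (j + N).+1 = scale e (x j.+1).
Proof.
move=> K1 KL xU xC xN xNN j.
have half k : exists2 e : R, e ^+ 2 = 1 & x (k + N)%N = scale e (x k).
  rewrite -{2}[k]addn0; apply: (half_period K1 KL (x := fun i => x (k + i)%N)).
  - by move=> i; exact: xU.
  - by move=> i; rewrite addnS; exact: xC.
  - by move=> i; rewrite !addnS; exact: xN.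
  - by rewrite xNN addn0.
have [e e2 xe] := half j; have [f f2 xf] := half j.+1.
exists e => //; rewrite -addSn xf; split=> //; congr (scale _ _).
(* Conjugacy of the two scaled vectors gives [e f = 1], hence [f = e]: consecutive terms share their
   sign. *)
have := xC (j + N)%N; rewrite -addSn xe xf /conjugate /=.
have -> : K * (e * (x j).1) * (f * (x j.+1).1) + L * (e * (x j).2) * (f * (x j.+1).2)
  = e * f * (K * (x j).1 * (x j.+1).1 + L * (x j).2 * (x j.+1).2) by ring.
rewrite (xC j) mulr1 => ef.
by rewrite -[LHS]mul1r -e2 expr2 -mulrA ef mulr1.
Qed.

(** * Vertices and contact points as one sequence *)

Definition interleave (T : Type) (p q : int -> T) (i : int) (j : nat) : T :=
  if odd j then q (i + j./2%:Z) else p (i + j./2%:Z).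

Lemma interleave_even (T : Type) (p q : int -> T) i k :
  interleave p q i k.*2 = p (i + k%:Z).
Proof. by rewrite /interleave odd_double doubleK. Qed.

Lemma interleave_odd (T : Type) (p q : int -> T) i k :
  interleave p q i k.*2.+1 = q (i + k%:Z).
Proof. by rewrite /interleave /= odd_double /= uphalf_double. Qed.

(** A split on the parity of [j]. The predicate also sees the index, so it can mention later terms
    of the sequence. *)
Lemma interleave_ind (T : Type) (p q : int -> T) i (S : nat -> T -> Prop) :
  (forall k, S k.*2 (p (i + k%:Z))) -> (forall k, S k.*2.+1 (q (i + k%:Z))) ->
  forall j, S j (interleave p q i j).
Proof.
move=> Se So j; rewrite -(odd_double_half j).
by case: (odd j); rewrite ?add0n ?add1n ?interleave_even ?interleave_odd.
Qed.

Lemma half_period_interleave (R : realFieldType) (K L : R) (p q : int -> R * R) N :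
  1 < K -> K < L ->
  (forall i, unit2 (p i)) -> (forall i, unit2 (q i)) ->
  (forall i, conjugate K L (p i) (q i)) -> (forall i, conjugate K L (q i) (p (i + 1))) ->
  (forall i, p (i + 1) <> p i) -> (forall i, q (i + 1) <> q i) ->
  (forall i, p (i + N%:Z) = p i) -> (forall i, q (i + N%:Z) = q i) ->
  forall i j, exists2 e : R, e ^+ 2 = 1 &
    interleave p q i (j + N)%N = scale e (interleave p q i j) /\
    interleave p q i (j + N).+1 = scale e (interleave p q i j.+1).
Proof.
move=> K1 KL pU qU pq qp pN qN pP qP i.
have S1 k : i + k.+1%:Z = i + k%:Z + 1 by lia.
apply: (half_period_pair K1 KL).
- by apply: (interleave_ind (S := fun _ => @unit2 R)).
- apply: (interleave_ind (S := fun j u => conjugate K L u (interleave p q i j.+1))) => k.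
    by rewrite interleave_odd.
  by rewrite -doubleS interleave_even S1.
- apply: (interleave_ind (S := fun j u => interleave p q i j.+2 <> u)) => k.
    by rewrite -doubleS interleave_even S1.
  by rewrite -doubleS interleave_odd S1.
- have SN k : i + (k + N)%:Z = i + k%:Z + N%:Z by lia.
  apply: (interleave_ind (S := fun j u => interleave p q i (j + (N + N)) = u)) => k;
    rewrite addnn ?addSn -doubleD.
    by rewrite interleave_even SN.
  by rewrite interleave_odd SN.
Qed.

(** * Tangents and chords of an ellipse *)

Section Ellipse.
Variables (R : realType).
Implicit Types A B T X : point R.

(** The polar line of [T], which is the tangent at [T] when [T] lies on the ellipse. *)
Definition polar (a b : R) T X : Prop :=
  T.1 * X.1 / a ^+ 2 + T.2 * X.2 / b ^+ 2 = 1.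

Lemma point_neq A B : A <> B -> 0 < (B.1 - A.1) ^+ 2 + (B.2 - A.2) ^+ 2.
Proof.
move=> AB; rewrite lt0r addr_ge0 ?sqr_ge0 // andbT.
rewrite paddr_eq0 ?sqr_ge0 // !sqrf_eq0 !subr_eq0.
apply/andP => -[/eqP e1 /eqP e2]; apply: AB.
exact: injective_projections.
Qed.

Lemma weighted_sqr_gt0 (k l x y : R) : 0 < k -> 0 < l -> 0 < x ^+ 2 + y ^+ 2 ->
  0 < x ^+ 2 * k + y ^+ 2 * l.
Proof.
move=> k0 l0; have [->|x0] := eqVneq (x ^+ 2) 0.
  by rewrite mul0r !add0r => y0; exact: mulr_gt0.
move=> _; apply: ltr_pwDl; last by rewrite mulr_ge0 ?sqr_ge0 ?ltW.
by rewrite pmulr_lgt0 // lt0r x0 sqr_ge0.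
Qed.

Lemma contact_polar a b A B T : 0 < a -> 0 < b -> A <> B ->
  contact_point a b A B T -> polar a b T A /\ polar a b T B.
Proof.
move=> a0 b0 AB [Te [[t Tt] Tu]]; move: Te Tu; rewrite /polar /on_ellipse.
have : 0 < (a ^+ 2)^-1 by rewrite invr_gt0 exprn_gt0.
have : 0 < (b ^+ 2)^-1 by rewrite invr_gt0 exprn_gt0.
move: (a ^+ 2)^-1 (b ^+ 2)^-1 => k l l0 k0 Te Tu.
pose d : point R := (B.1 - A.1, B.2 - A.2).
have d0 : 0 < d.1 ^+ 2 + d.2 ^+ 2 by exact: point_neq.
pose g := d.1 ^+ 2 * k + d.2 ^+ 2 * l.
pose h := k * T.1 * d.1 + l * T.2 * d.2.
have g0 : g != 0.
  by rewrite gt_eqF // weighted_sqr_gt0.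
(* The line meets the ellipse again at [T + s d]. Uniqueness of the contact point forces [s = 0],
   hence [h = 0]: the direction [d] satisfies the tangency equation. *)
pose s := - 2 * h / g.
have sg : s * g = - 2 * h by rewrite mulfVK.
have XT : (T.1 + s * d.1, T.2 + s * d.2) = T.
  apply: Tu => /=.
    have -> : (T.1 + s * d.1) ^+ 2 * k + (T.2 + s * d.2) ^+ 2 * l
      = T.1 ^+ 2 * k + T.2 ^+ 2 * l + s * (2 * h + s * g) by rewrite /h /g; ring.
    by rewrite sg Te; ring.
  by exists (t + s); rewrite Tt /=; congr pair; ring.
have h0 : h = 0.
  have [e1 e2] : s * d.1 = 0 /\ s * d.2 = 0.
    have := congr1 fst XT; have := congr1 snd XT => /= e2 e1.
    by split; lra.
  have : s ^+ 2 * (d.1 ^+ 2 + d.2 ^+ 2) = 0.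
    by rewrite mulrDr -!exprMn e1 e2; ring.
  move/eqP; rewrite mulf_eq0 sqrf_eq0 (gt_eqF d0) orbF => /eqP s0.
  by move: sg; rewrite s0; lra.
have TAt : A = (T.1 - t * d.1, T.2 - t * d.2).
  by rewrite Tt /= [LHS]surjective_pairing; congr pair; ring.
have TBt : B = (T.1 + (1 - t) * d.1, T.2 + (1 - t) * d.2).
  by rewrite Tt /= [LHS]surjective_pairing; congr pair; ring.
have pol z : T.1 * (T.1 + z * d.1) * k + T.2 * (T.2 + z * d.2) * l = 1.
  have -> : T.1 * (T.1 + z * d.1) * k + T.2 * (T.2 + z * d.2) * l
    = T.1 ^+ 2 * k + T.2 ^+ 2 * l + z * h by rewrite /h; ring.
  by rewrite Te h0; ring.
split; [rewrite TAt -!mulNr|rewrite TBt]; exact: pol.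
Qed.

Lemma on_line_polar a b T A B X : A <> B -> polar a b T A -> polar a b T B ->
  on_line A B X <-> polar a b T X.
Proof.
rewrite /polar; move: (a ^+ 2)^-1 (b ^+ 2)^-1 => k l AB hA hB; split.
  case=> t -> /=.
  have -> : T.1 * (A.1 + t * (B.1 - A.1)) * k + T.2 * (A.2 + t * (B.2 - A.2)) * l
   = (1 - t) * (T.1 * A.1 * k + T.2 * A.2 * l)
     + t * (T.1 * B.1 * k + T.2 * B.2 * l) by ring.
  by rewrite hA hB; ring.
move=> hX; have d0 := point_neq AB.
pose d : point R := (B.1 - A.1, B.2 - A.2); pose e : point R := (X.1 - A.1, X.2 - A.2).
rewrite -/d in d0.
(* Both [d] and [e] are orthogonal to [(T.1 k, T.2 l)], hence parallel. That this normal is nonzero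
   enters by multiplying with the polar form at [A], which is 1. *)
have dd : d.1 * e.2 - d.2 * e.1 = 0.
  have hd : T.1 * k * d.1 + T.2 * l * d.2 = 0.
    have -> : T.1 * k * d.1 + T.2 * l * d.2
      = (T.1 * B.1 * k + T.2 * B.2 * l) - (T.1 * A.1 * k + T.2 * A.2 * l).
      by rewrite /d /=; ring.
    by rewrite hA hB subrr.
  have he : T.1 * k * e.1 + T.2 * l * e.2 = 0.
    have -> : T.1 * k * e.1 + T.2 * l * e.2
      = (T.1 * X.1 * k + T.2 * X.2 * l) - (T.1 * A.1 * k + T.2 * A.2 * l).
      by rewrite /e /=; ring.
    by rewrite hA hX subrr.
  rewrite -[LHS]mul1r -hA.
  have -> : (T.1 * A.1 * k + T.2 * A.2 * l) * (d.1 * e.2 - d.2 * e.1)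
   = (T.1 * k * d.1 + T.2 * l * d.2) * (A.1 * e.2 - A.2 * e.1)
     - (T.1 * k * e.1 + T.2 * l * e.2) * (A.1 * d.2 - A.2 * d.1) by ring.
  by rewrite hd he; ring.
pose n := d.1 ^+ 2 + d.2 ^+ 2; have n0 : n != 0 by rewrite gt_eqF.
(* The parameter of the orthogonal projection of [X] to the line. *)
exists ((e.1 * d.1 + e.2 * d.2) / n); rewrite [LHS]surjective_pairing.
congr pair; apply/eqP; rewrite [eqbRHS]addrC -subr_eq; apply/eqP/(mulfI n0).
- have -> : n * (X.1 - A.1) = (e.1 * d.1 + e.2 * d.2) * d.1
     - (d.1 * e.2 - d.2 * e.1) * d.2 by rewrite /n /e /=; ring.
  by rewrite dd mul0r subr0 mulrA [n * _]mulrC divfK.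
- have -> : n * (X.2 - A.2) = (e.1 * d.1 + e.2 * d.2) * d.2
     + (d.1 * e.2 - d.2 * e.1) * d.1 by rewrite /n /e /=; ring.
  by rewrite dd mul0r addr0 mulrA [n * _]mulrC divfK.
Qed.

Lemma dist_line A B t :
  dist A (A.1 + t * (B.1 - A.1), A.2 + t * (B.2 - A.2)) = `|t| * dist A B.
Proof.
rewrite /dist -sqrtr_sqr -sqrtrM ?sqr_ge0 //=; congr Num.sqrt; ring.
Qed.

Lemma distC A B : dist A B = dist B A.
Proof. by rewrite /dist; congr Num.sqrt; ring. Qed.

(** At parameter [t] the quadratic form is [1 - g t (1 - t)], so a point of the line not outside the
    ellipse has [0 <= t <= 1] and lies between [A] and [B]. *)
Lemma dist_chord a b A B T : 0 < a -> 0 < b -> A <> B ->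
  on_ellipse a b A -> on_ellipse a b B -> on_line A B T ->
  T.1 ^+ 2 / a ^+ 2 + T.2 ^+ 2 / b ^+ 2 <= 1 ->
  dist A B = dist A T + dist B T.
Proof.
move=> a0 b0 AB hA hB [t ->] /= hT.
have t01 : 0 <= t <= 1.
  have d0 := point_neq AB; move: hA hB hT; rewrite /on_ellipse.
  have : 0 < (a ^+ 2)^-1 by rewrite invr_gt0 exprn_gt0.
  have : 0 < (b ^+ 2)^-1 by rewrite invr_gt0 exprn_gt0.
  move: (a ^+ 2)^-1 (b ^+ 2)^-1 => k l l0 k0 hA hB.
  pose g := (B.1 - A.1) ^+ 2 * k + (B.2 - A.2) ^+ 2 * l.
  have g0 : 0 < g by exact: weighted_sqr_gt0.
  have -> : (A.1 + t * (B.1 - A.1)) ^+ 2 * k + (A.2 + t * (B.2 - A.2)) ^+ 2 * l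
    = (1 - t) * (A.1 ^+ 2 * k + A.2 ^+ 2 * l) + t * (B.1 ^+ 2 * k + B.2 ^+ 2 * l)
      - g * (t * (1 - t)) by rewrite /g; ring.
  rewrite hA hB => hT.
  have : 0 <= g * (t * (1 - t)) by lra.
  rewrite pmulr_rge0 // => h; apply/andP; split; rewrite leNgt; apply/negP => t0.
    by move: h; rewrite nmulr_rge0 //; lra.
  by move: h; rewrite pmulr_rge0; lra.
rewrite dist_line.
have -> : (A.1 + t * (B.1 - A.1), A.2 + t * (B.2 - A.2))
  = (B.1 + (1 - t) * (A.1 - B.1), B.2 + (1 - t) * (A.2 - B.2)) by congr pair; ring.
rewrite dist_line [dist B A]distC.
by rewrite !ger0_norm; [ring|lra|lra].
Qed.

(** * Normalized coordinates and Ivory's theorem *)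

Definition normalize (a b : R) X : point R := (X.1 / a, X.2 / b).

Lemma normalize_unit a b X : on_ellipse a b X -> unit2 (normalize a b X).
Proof. by rewrite /on_ellipse /unit2 /= !expr_div_n. Qed.

Lemma normalize_inj a b : a != 0 -> b != 0 -> injective (normalize a b).
Proof.
move=> a0 b0 [x y] [x' y'] []; rewrite /= => e1 e2.
by rewrite (mulIf (invr_neq0 a0) e1) (mulIf (invr_neq0 b0) e2).
Qed.

(* The distance between the points of [e] and [c] with normalized coordinates
   [u] and [v] respectively. *)
Definition cross_dist (ae be ac bc : R) (u v : R * R) : R :=
  Num.sqrt ((ae * u.1 - ac * v.1) ^+ 2 + (be * u.2 - bc * v.2) ^+ 2).

Lemma cross_distE ae be ac bc X Y : ae != 0 -> be != 0 -> ac != 0 -> bc != 0 ->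
  dist X Y = cross_dist ae be ac bc (normalize ae be X) (normalize ac bc Y).
Proof.
move=> *; rewrite /dist /cross_dist /=.
by rewrite ![_ * (_ / _)]mulrC !divfK.
Qed.

(** By confocality both differences of squared semiaxes are [ke], so the squared distances differ by
    [ke] times the difference of the squared norms of [u] and [v], which is 0. *)
Lemma ivory ae be ac bc ke u v :
  ae ^+ 2 = ac ^+ 2 + ke -> be ^+ 2 = bc ^+ 2 + ke -> unit2 u -> unit2 v ->
  cross_dist ae be ac bc u v = cross_dist ae be ac bc v u.
Proof.
rewrite /unit2 => ha hb hu hv; congr Num.sqrt; apply/eqP; rewrite -subr_eq0.
apply/eqP; transitivity ((ae ^+ 2 - ac ^+ 2) * (u.1 ^+ 2 - v.1 ^+ 2)
   + (be ^+ 2 - bc ^+ 2) * (u.2 ^+ 2 - v.2 ^+ 2)); first by ring.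
rewrite ha hb.
transitivity (ke * ((u.1 ^+ 2 + u.2 ^+ 2) - (v.1 ^+ 2 + v.2 ^+ 2))); first by ring.
by rewrite hu hv; ring.
Qed.

Lemma cross_dist_scale ae be ac bc e u v : e ^+ 2 = 1 ->
  cross_dist ae be ac bc (scale e u) (scale e v) = cross_dist ae be ac bc u v.
Proof.
move=> e2; congr Num.sqrt => /=.
transitivity (e ^+ 2 * ((ae * u.1 - ac * v.1) ^+ 2 + (be * u.2 - bc * v.2) ^+ 2)).
  by ring.
by rewrite e2 mul1r.
Qed.

(** Shifting by one step replaces the first term by one a full period later, which is equal to
    it. *)
Lemma sum_shift (f : int -> R) N (m : nat) : (forall i, f (i + N%:Z) = f i) ->
  \sum_(1 <= i < N.+1) f (i%:Z + m%:Z) = \sum_(1 <= i < N.+1) f i%:Z.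
Proof.
move=> fN; elim: m => [|m IH]; first by apply: eq_bigr => i _; rewrite addr0.
rewrite -IH.
transitivity (\sum_(1 <= i < N.+1) f (i.+1%:Z + m%:Z)).
  by apply: eq_bigr => i _; congr f; lia.
case: N fN {IH} => [|N] fN; first by rewrite !big_geq.
rewrite big_nat_recr //= [RHS]big_ltn // [RHS]addrC [in RHS]big_add1 /=; congr (_ + _).
by rewrite -(fN (1%:Z + m%:Z)); congr f; lia.
Qed.

Lemma same_line_polar a b T A B C D : A <> B -> C <> D ->
  polar a b T A -> polar a b T B -> polar a b T C -> polar a b T D ->
  same_line A B C D.
Proof.
move=> AB CD hA hB hC hD X.
exact: iff_trans (on_line_polar X AB hA hB) (iff_sym (on_line_polar X CD hC hD)).
Qed.

Lemma polar_conjugate ae be ac bc T X : ae != 0 -> be != 0 -> ac != 0 -> bc != 0 ->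
  polar ac bc T X -> conjugate (ae / ac) (be / bc) (normalize ae be X) (normalize ac bc T).
Proof.
move=> ae0 be0 ac0 bc0; rewrite /polar /conjugate /= => <-; field.
by rewrite ae0 be0 ac0 bc0.
Qed.

End Ellipse.

(** * The billiard as a periodic orbit of normalized points *)

Theorem theorem4p5 (R : realType) (ac bc ke ae be : R) (N : nat)
    (P Q : int -> point R) :
  0 < bc -> bc < ac -> 0 < ke -> 0 < ae -> 0 < be ->
  ae ^+ 2 = ac ^+ 2 + ke -> be ^+ 2 = bc ^+ 2 + ke ->
  periodic_billiard ae be ac bc N P ->
  (forall i : int, contact_point ac bc (P i) (P (i + 1)) (Q i)) ->
  let l := fun i : int => dist (P i) (Q i) in
  let r := fun i : int => dist (P i) (Q (i - 1)) in
  let Le := \sum_(1 <= i < N.+1) dist (P i%:Z) (P (i%:Z + 1)) in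
  (forall n : nat, N = (2 * n)%N ->
     forall i : int, r (i + n%:Z) = r i /\ l (i + n%:Z) = l i) /\
  (forall n : nat, N = (2 * n).+1 ->
     (forall i : int, r (i + n%:Z) = l (i - 1) /\ l (i + n%:Z) = r i) /\
     \sum_(1 <= i < N.+1) l i%:Z = Le / 2 /\
     \sum_(1 <= i < N.+1) r i%:Z = Le / 2).
Proof.
have i1 (i : int) : i - 1 + 1%:Z = i by rewrite subrK.
have iN n (i : int) k : i - 1 + (k + n)%:Z = i - 1 + k%:Z + n%:Z by lia.
have iS n (i : int) : i - 1 + n.+1%:Z = i + n%:Z by lia.
have iB n (i : int) : i - 1 + n%:Z = i + n%:Z - 1 by lia.
have N2 n k : N = (2 * n)%N -> (k.*2 + N)%N = (k + n).*2 by lia.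
have N2S n k : N = (2 * n).+1 -> (k.*2 + N)%N = (k + n).*2.+1 by lia.
move=> bc0 bcac ke0 ae0 be0 hae hbe [bil _ PN _] hQ l r Le.
have ac0 : 0 < ac by lra.
have [[aen ben] [acn bcn]] : (ae != 0 /\ be != 0) /\ (ac != 0 /\ bc != 0).
  by rewrite !gt_eqF.
have Pe i : on_ellipse ae be (P i) by case: (bil i).
have Qe i : on_ellipse ac bc (Q i) by case: (hQ i).
have PP i : P i <> P (i + 1) by case: (bil i) => _ /nesym.
have pol i := contact_polar ac0 bc0 (PP i) (hQ i).
(* Equal consecutive contact points would put both sides on the same polar line, against the
   billiard condition. *)
have QQ i : Q (i + 1) <> Q i.
  move=> QQ; have [_ _ _] := bil (i + 1); apply; rewrite addrK.
  have [pA pB] := pol i; have := pol (i + 1); rewrite QQ => -[pC pD].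
  by apply: same_line_polar pA pB pC pD.
(* Uniqueness of the contact point carries the period of [P] over to [Q]. *)
have QN i : Q (i + N%:Z) = Q i.
  case: (hQ i) => _ [_]; apply; first exact: Qe.
  have [_ [h _]] := hQ (i + N%:Z).
  by move: h; rewrite addrAC !PN.
have K1 : 1 < ae / ac.
  by rewrite ltr_pdivlMr // mul1r -(@ltr_pXn2r _ 2) ?nnegrE ?ltW // hae; lra.
(* The squared ratios are [1 + ke / ac^2] and [1 + ke / bc^2], with [bc < ac]. *)
have KL : ae / ac < be / bc.
  rewrite -(@ltr_pXn2r _ 2) ?nnegrE ?divr_ge0 ?ltW // !expr_div_n hae hbe.
  rewrite !mulrDl !divff ?expf_neq0 // ltrD2l ltr_pM2l // ltf_pV2 ?posrE ?exprn_gt0 //.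
  by rewrite ltrXn2r // ?ltW.
pose p i := normalize ae be (P i); pose q i := normalize ac bc (Q i).
have pU i : unit2 (p i) by exact: normalize_unit.
have qU i : unit2 (q i) by exact: normalize_unit.
have pq i : conjugate (ae / ac) (be / bc) (p i) (q i).
  by apply: polar_conjugate => //; case: (pol i).
have qp i : conjugate (ae / ac) (be / bc) (q i) (p (i + 1)).
  by apply/conjugateC/polar_conjugate => //; case: (pol i).
have pN i : p (i + 1) <> p i by move/normalize_inj => /(_ aen ben)/esym/PP.
have qN i : q (i + 1) <> q i by move/normalize_inj => /(_ acn bcn)/QQ.
have pP i : p (i + N%:Z) = p i by rewrite /p PN.
have qP i : q (i + N%:Z) = q i by rewrite /q QN.
have half := half_period_interleave K1 KL pU qU pq qp pN qN pP qP.
have lE i : l i = cross_dist ae be ac bc (p i) (q i) by exact: cross_distE.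
have rE i : r i = cross_dist ae be ac bc (p i) (q (i - 1)) by exact: cross_distE.
have iv u v (hu : unit2 u) (hv : unit2 v) := ivory hae hbe hu hv.
split=> n Nn.
  move=> i; rewrite !rE !lE; split.
    (* The orbit based at [i - 1] runs [P_{i-1}, Q_{i-1}, P_i, Q_i], so term 1 is the contact point
       before [P_i]. The even shift [N = 2 n] sends vertices to vertices. *)
    have [e e2 []] := half (i - 1) 0.*2.+1.
    rewrite addSn (N2 n) // -doubleS -addSn.
    rewrite -[0.*2.+2]/(1.*2) !interleave_even !interleave_odd.
    rewrite !iN i1 addr0 => eq ep.
    by rewrite ep addrAC eq cross_dist_scale.
  have [e e2 []] := half (i - 1) 1.*2.
  rewrite (N2 n) // !interleave_even !interleave_odd !iN !i1 => -> ->.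
  exact: cross_dist_scale.
(* An odd shift exchanges vertices and contact points; Ivory's theorem exchanges them back in the
   distances. *)
have odd_half i : r (i + n%:Z) = l (i - 1) /\ l (i + n%:Z) = r i.
  rewrite !rE !lE; split.
    have [e e2 []] := half (i - 1) 0.*2.
    rewrite (N2S n) // -doubleS interleave_even !interleave_odd interleave_even.
    by rewrite iS iB addr0 => -> ->; rewrite cross_dist_scale // iv.
  have [e e2 []] := half (i - 1) 0.*2.+1.
  rewrite addSn (N2S n) // -doubleS -[0.*2.+2]/(1.*2).
  rewrite !interleave_even !interleave_odd iS.
  by rewrite addr0 i1 => -> ->; rewrite cross_dist_scale // iv.
have lP i : l (i + N%:Z) = l i by rewrite /l PN QN.
have rP i : r (i + N%:Z) = r i by rewrite /r PN addrAC QN.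
have rl : \sum_(1 <= i < N.+1) r i%:Z = \sum_(1 <= i < N.+1) l i%:Z.
  rewrite -(sum_shift n lP); apply: eq_bigr => i _.
  by case: (odd_half i%:Z).
suff -> : Le = \sum_(1 <= i < N.+1) l i%:Z + \sum_(1 <= i < N.+1) r i%:Z.
  split; first exact: odd_half.
  by rewrite rl; split; lra.
(* The side from [P_i] to [P_{i+1}] splits at [Q_i] into [l_i] and [r_{i+1}], hence the shift by
   1. *)
rewrite -[X in _ + X](sum_shift 1 rP) -big_split; apply: eq_bigr => i _ /=.
rewrite /l /r addrK; apply: (dist_chord ae0 be0) => //.
  by case: (hQ i%:Z) => _ [].
(* The contact point is not outside [e], whose semiaxes exceed those of [c]. *)
have := Qe i%:Z; rewrite /on_ellipse => <-.
by rewrite lerD // ler_wpM2l ?sqr_ge0 // lef_pV2 ?posrE ?exprn_gt0 // ?hae ?hbe lerDl ltW.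
Qed.
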